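(* The theory $T=\operatorname{Th}(\mathbb{N},\cdot,1)$ does not eliminate finite imaginaries; that is, it is not the case that for every $n$ every finite subset of $\mathbb{M}^n$ has a canonical parameter.
   Context: $\mathbb{N}$ denotes the non-zero natural numbers, and $T$ is the complete first-order theory of the multiplicative monoid $(\mathbb{N},\cdot,1)$ (Skolem arithmetic). $\mathbb{M}\models T$ is a fixed monster model with $\mathbb{N}\prec\mathbb{M}$: a special structure of cardinality $\beth_{\mu^+}(\mu)$ for some suitably large cardinal $\mu$; ''small'' means of size $<\mu^+$. ''$B$-definable'' means definable by a first-order formula with parameters from $B$. Let $D\subseteq\mathbb{M}^n$ be $X$-definable for some finite set $X\subset\mathbb{M}$. Then $X$ is a canonical parameter for $D$ if $X$ is fixed pointwise by every automorphism of $\mathbb{M}$ fixing $D$ setwise. The theory $T$ has elimination of finite imaginaries if every finite subset of $\mathbb{M}^n$ (for every $n$) has a canonical parameter. *)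

(* Defs.v *)
From mathcomp Require Import all_boot.
From mathcomp Require Import boolp classical_sets functions cardinality wochoice.

Set Implicit Arguments.
Unset Strict Implicit.
Unset Printing Implicit Defensive.

Local Open Scope classical_set_scope.
Local Open Scope card_scope.

(** * First-order logic in the language of monoids *)

(* No axioms: these are arbitrary structures for the language (., 1). *)
Record structure := Structure {
  dom :> Type;
  one : dom;
  mul : dom -> dom -> dom
}.

Arguments one {_}.

Inductive term (V : Type) :=
| TVar of V
| TOne
| TMul of term V & term V.

(* [formula V] is the type of formulas with free variables in [V]; under the
   quantifier, the bound variable is [None]. *)
Inductive formula (V : Type) :=
| FEq of term V & term V
| FNot of formula V
| FAnd of formula V & formula V
| FEx of formula (option V).

Fixpoint eval (M : structure) (V : Type) (e : V -> M) (t : term V) : M :=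
  match t with
  | TVar v => e v
  | TOne => one
  | TMul t1 t2 => mul (eval e t1) (eval e t2)
  end.

Fixpoint sat (M : structure) (V : Type) (phi : formula V) : (V -> M) -> Prop :=
  match phi with
  | FEq t1 t2 => fun e => eval e t1 = eval e t2
  | FNot phi1 => fun e => ~ sat phi1 e
  | FAnd phi1 phi2 => fun e => sat phi1 e /\ sat phi2 e
  | FEx phi1 => fun e => exists a : M, sat phi1 (oapp e a)
  end.

Definition theory := set (formula void).

Definition Th (M : structure) : theory :=
  [set phi | sat phi (of_void M)].

Definition models (M : structure) (T : theory) : Prop :=
  forall phi, T phi -> sat phi (of_void M).

Definition elementary (M N : structure) (f : M -> N) : Prop :=
  forall n (phi : formula 'I_n) (e : 'I_n -> M), sat phi e <-> sat phi (f \o e).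

Definition automorphism (M : structure) (f : M -> M) : Prop :=
  [/\ bijective f, f one = one & forall x y, f (mul x y) = mul (f x) (f y)].

Definition definable (M : structure) (B : set M) n (D : set (n.-tuple M)) :
    Prop :=
  exists m (b : 'I_m -> M) (phi : formula ('I_n + 'I_m)),
    (forall j, B (b j)) /\
    D = [set x | sat phi (fun v => match v with
                                   | inl i => tnth x i
                                   | inr j => b j
                                   end)].

(** * Skolem arithmetic *)

Definition posnat := {n : nat | 0 < n}.

Lemma posnat_mul_gt0 (m n : posnat) : 0 < val m * val n.
Proof. by rewrite muln_gt0 (valP m) (valP n). Qed.

Definition posnat_structure : structure :=
  @Structure posnat (exist _ 1 isT)
    (fun m n => exist _ (val m * val n) (posnat_mul_gt0 m n)).

Definition skolem_arithmetic : theory := Th posnat_structure.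

(** * Special structures *)

Record substructure (M : structure) := Substructure {
  carrier :> set M;
  carrier1 : carrier one;
  carrierM : forall x y, carrier x -> carrier y -> carrier (mul x y)
}.

Definition induced (M : structure) (A : substructure M) : structure :=
  @Structure (set_type A)
    (exist _ one (mem_set (carrier1 A)))
    (fun x y => exist _ (mul (val x) (val y))
       (mem_set (carrierM (set_mem (valP x)) (set_mem (valP y))))).

Definition incl (M : structure) (A B : substructure M) (AB : A `<=` B) :
    induced A -> induced B :=
  fun x => exist _ (val x) (mem_set (AB _ (set_mem (valP x)))).

Definition elementary_sub (M : structure) (A B : substructure M) : Prop :=
  exists AB : A `<=` B, elementary (incl AB).

(* A set of formulas in one variable, [None], with parameters in [B]. *)
Definition finitely_satisfiable (M : structure) (B : set M)
    (p : set (formula (option B))) : Prop :=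
  forall q, finite_set q -> q `<=` p ->
    exists a : M, forall phi, q phi -> sat phi (oapp val a).

(* |L|^+-saturation: a set has fewer than |L|^+ elements iff it has at most
   |L| elements. *)
Definition succ_saturated (U : Type) (L : set U) (M : structure) : Prop :=
  forall B : set M, B #<= L ->
  forall p : set (formula (option B)), finitely_satisfiable p ->
    exists a : M, forall phi, p phi -> sat phi (oapp val a).

Definition smaller (T : Type) (S : set T) : Prop := ~ ([set: T] #<= S).

(* The cardinals below |M| are represented by the subsets S of M with
   |S| < |M|; by the first clause, A S depends only on the cardinal of S. *)
Definition special (M : structure) : Prop :=
  exists A : set M -> substructure M,
    [/\ forall S S', smaller S' -> S #<= S' -> elementary_sub (A S) (A S'),
        forall S, smaller S -> succ_saturated S (induced (A S))
      & forall x : M, exists2 S, smaller S & carrier (A S) x].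

(** * The cardinal beth_(mu^+)(mu) *)

Definition initial_segment (W : Type) (R : rel W) (w : W) : set W :=
  [set v | R v w /\ v <> w].

(* (W, R) has the order type of the initial ordinal mu^+. *)
Definition succ_cardinal (mu W : Type) (R : rel W) : Prop :=
  [/\ well_order R,
      forall w, initial_segment R w #<= [set: mu]
    & ~ ([set: W] #<= [set: mu])].

(* It is enough to compare X with its own subsets, since cardinals are
   linearly ordered; this avoids a quantification over a universe. *)
Definition card_sup (I : Type) (P : set I) (F : I -> Type) (X : Type) : Prop :=
  (forall i, P i -> [set: F i] #<= [set: X]) /\
  (forall Y : set X, (forall i, P i -> [set: F i] #<= Y) -> [set: X] #<= Y).

Definition is_zero (W : Type) (R : rel W) (w : W) : Prop :=
  initial_segment R w = set0.

Definition is_succ (W : Type) (R : rel W) (v w : W) : Prop :=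
  initial_segment R w = initial_segment R v `|` [set v].

Definition is_limit (W : Type) (R : rel W) (w : W) : Prop :=
  ~ is_zero R w /\ forall v, ~ is_succ R v w.

Definition beth_sequence (mu W : Type) (R : rel W) (beth : W -> Type) : Prop :=
  [/\ forall w, is_zero R w -> [set: beth w] #= [set: mu],
      forall v w, is_succ R v w -> [set: beth w] #= [set: set (beth v)]
    & forall w, is_limit R w -> card_sup (initial_segment R w) beth (beth w)].

(* mu^+ is a limit ordinal, so beth_(mu^+)(mu) is the supremum of the
   beth_w(mu), w < mu^+. *)
Definition card_beth_succ (mu X : Type) : Prop :=
  exists (W : Type) (R : rel W) (beth : W -> Type),
    [/\ succ_cardinal mu R, beth_sequence mu R beth & card_sup setT beth X].

(** * Monster models and finite imaginaries *)

Definition monster_model (mu : Type) (M : structure) : Prop :=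
  [/\ models M skolem_arithmetic,
      exists i : posnat_structure -> M, elementary i,
      special M
    & card_beth_succ mu M].

Definition canonical_parameter (M : structure) n (D : set (n.-tuple M))
    (X : set M) : Prop :=
  [/\ finite_set X,
      definable X D
    & forall f : M -> M, automorphism f ->
        [set map_tuple f x | x in D] = D -> forall x, X x -> f x = x].

Definition eliminates_finite_imaginaries (M : structure) : Prop :=
  forall n (D : set (n.-tuple M)), finite_set D ->
    exists X : set M, canonical_parameter D X.

(* Main.v *)
(* Take standard primes p, q, r, s and D = {(p,q), (r,s)}. Every element of a
   model is uniquely the product of a p-primary and a p-free part, so any
   isomorphism f between the p-primary and the r-primary elements yields an
   automorphism tau of the whole model that exchanges the two parts along f and
   keeps the rest; likewise tau' exchanges the q- and s-parts. The composite of
   tau and tau' permutes D, and an element that it fixes has an r-part which is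
   the image under f of its p-part, hence is already fixed by tau. So tau fixes
   every candidate canonical parameter of D pointwise, although it moves (p,q) to
   (r,q), which is not in D.

   The isomorphism f is the restriction of an automorphism mapping p to r: the
   standard model has one, so p and r have the same type in the monster, and
   special structures are homogeneous by back-and-forth along an enumeration in
   which each element and the fewer than |M| elements before it lie in a common
   layer that is saturated over that many parameters. *)
From mathcomp Require Import all_boot.
From mathcomp Require Import boolp classical_sets functions cardinality wochoice.
Require Import Defs.

Set Implicit Arguments.
Unset Strict Implicit.
Unset Printing Implicit Defensive.

Local Open Scope classical_set_scope.
Local Open Scope card_scope.

(** * Cardinals and well-orders *)

(** The relation [r] need not be single-valued, since choice picks values afterwards. In this form
    an embedding needs no function on all of [T] and no default value in [U], and embeddings of
    pieces are glued by a disjunction. *)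
Lemma card_le_relP (T U : Type) (A : set T) (B : set U) :
  A #<= B <-> exists r : T -> U -> Prop,
    (forall x, A x -> exists2 y, B y & r x y) /\
    (forall x x' y, A x -> A x' -> r x y -> r x' y -> x = x').
Proof.
split=> [/card_leP/injfunPex[f _ finj]|[r [rtot rinj]]].
  exists (fun x y => exists a b, [/\ val a = x, val b = y & f a = b]); split.
    move=> x Ax; exists (val (f (SigSub (mem_set Ax)))); first exact: set_valP.
    by exists (SigSub (mem_set Ax)), (f (SigSub (mem_set Ax))).
  move=> x x' y _ _ [a [b [<- <- fab]]] [a' [b' [<- /val_inj bb fab']]].
  by congr val; apply: finj; rewrite ?inE// fab fab' bb.
have /choice[f fP] (a : A) : exists b : B, r (val a) (val b).
  have [y By ray] := rtot _ (set_valP a).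
  by exists (SigSub (mem_set By)).
apply/card_leP/injfunPex; exists f => // a a' _ _ /= faa'; apply: val_inj.
apply: (rinj _ _ (val (f a'))) => //; try exact: set_valP.
by rewrite -faa'.
Qed.

Lemma card_leU_disj (T U : Type) (A A' : set T) (B B' : set U) :
  A #<= B -> A' #<= B' -> B `&` B' = set0 -> A `|` A' #<= B `|` B'.
Proof.
move=> /card_le_relP[r [rtot rinj]] /card_le_relP[s [stot sinj]] BB0.
have disj y : B y -> B' y -> False.
  by move=> By B'y; have : set0 y by rewrite -BB0; split.
apply/card_le_relP.
exists (fun x y => A x /\ B y /\ r x y \/ ~ A x /\ B' y /\ s x y); split.
  move=> x AAx; have [Ax|nAx] := pselect (A x).
    by have [y By rxy] := rtot _ Ax; exists y; [left|left].
  case: AAx => // A'x; have [y B'y sxy] := stot _ A'x.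
  by exists y; [right|right].
move=> x x' y [Ax|A'x] [Ax'|A'x'] [[? [? ?]]|[? [? ?]]] [[? [? ?]]|[? [? ?]]] //;
  by [apply: rinj; eauto | apply: sinj; eauto | exfalso; apply: (disj y)].
Qed.

Lemma countableU (T : Type) (A B : set T) :
  countable A -> countable B -> countable (A `|` B).
Proof.
move=> cA cB; have -> : A `|` B = \bigcup_b (if b then A else B).
  apply/seteqP; split=> [x [Ax|Bx]|x [[] _]]; [by exists true|by exists false|..];
    by [left|right].
by apply: bigcup_countable => [|[]].
Qed.

Lemma infinite_countable_subset (T : Type) (A : set T) :
  infinite_set A -> exists N, [/\ N `<=` A, countable N & infinite_set N].
Proof.
move=> /infiniteP /card_subP[N Nnat NA]; exists N; split => //.
  by rewrite /countable; move: Nnat; rewrite card_eq_le => /andP[].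
by apply/infiniteP; move: Nnat; rewrite card_eq_le => /andP[].
Qed.

Lemma countable_card_le (T U : Type) (A : set T) (B : set U) :
  countable A -> infinite_set B -> A #<= B.
Proof. by move=> cA /infiniteP; exact: card_le_trans. Qed.

(** [A] contains a countably infinite [N]. The countable set consisting of [N] and [C] embeds back
    into [N], while the rest of [A] stays in place. *)
Lemma card_leU_countable (T : Type) (A C : set T) :
  infinite_set A -> countable C -> A `|` C #<= A.
Proof.
move=> /infinite_countable_subset[N [NA cN iN]] cC.
apply: (@card_le_trans _ _ _ ((A `\` N) `|` (N `|` C))).
  apply: subset_card_le => x [Ax|Cx]; last by right; right.
  by have [Nx|Nx] := pselect (N x); [right; left|left].
apply: (@card_le_trans _ _ _ ((A `\` N) `|` N)); last first.
  by apply: subset_card_le => x [[]//|/NA].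
apply: card_leU_disj (card_lexx _) _ _.
  by apply: countable_card_le => //; exact: countableU.
by rewrite setDE -setIA setICl setI0.
Qed.

(** Take a maximal disjoint family [E] of countably infinite subsets of [A]. Its union [D] misses
    only finitely many points of [A], by maximality, and the doubling is done inside each countable
    member of [E] separately. *)
Lemma card_le_setXbool (T : Type) (A : set T) :
  infinite_set A -> A `*` [set: bool] #<= A.
Proof.
move=> infA.
have [E [EB tE maxE]] := @ex_maximal_disjoint_subcollection (set T) T id
  [set N | [/\ N `<=` A, countable N & infinite_set N]].
pose D := \bigcup_(N in E) N.
have DA : D `<=` A by apply: bigcup_sub => N /EB[].
have finAD : finite_set (A `\` D).
  apply: contrapT => /infinite_countable_subset[N [NAD cN iN]].
  have [x Nx] := infinite_setN0 iN.
  have nEN : ~ E N by move=> EN; case: (NAD _ Nx) => _; apply; exists N.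
  apply: (maxE (E `|` [set N])).
  - split; first by move=> X; left.
    by move=> /(_ N (or_intror erefl)).
  - move=> X [/EB//|->]; split => //.
    by apply: subset_trans NAD _ => y [].
  - move=> X Y [EX|->] [EY|->] //=; first exact: tE.
      by move=> [y [Xy /NAD[_ []]]]; exists X.
    by move=> [y [/NAD[_ nDy] Yy]]; case: nDy; exists Y.
have infD : infinite_set D.
  move=> finD; apply: infA; apply: sub_finite_set (A `\` D `|` D) _ _.
    by move=> x Ax; have [|] := pselect (D x); [right|left].
  by rewrite finite_setU.
have AD : A #<= D.
  apply: (@card_le_trans _ _ _ (D `|` (A `\` D))).
    by apply: subset_card_le => x Ax; have [|] := pselect (D x); [left|right].
  by apply: card_leU_countable => //; exact: finite_set_countable.
suff DD : D `*` [set: bool] #<= D.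
  have /card_le_relP[r [rtot rinj]] := AD.
  apply: card_le_trans (_ : D `*` [set: bool] #<= _); last first.
    exact: card_le_trans DD (subset_card_le DA).
  apply/card_le_relP; exists (fun x y => r x.1 y.1 /\ x.2 = y.2); split.
    move=> [x b] [/= /rtot[y Dy rxy] _]; exists (y, b) => //.
  move=> [x b] [x' b'] [y c] /= [Ax _] [Ax' _] [rxy ->] [rx'y ->].
  by rewrite (rinj _ _ _ Ax Ax' rxy rx'y).
have /choice[r rP] (N : set T) : exists r : T * bool -> T -> Prop, E N ->
    (forall x, (N `*` [set: bool]) x -> exists2 y, N y & r x y) /\
    (forall x x' y, (N `*` [set: bool]) x -> (N `*` [set: bool]) x' ->
       r x y -> r x' y -> x = x').
  have [/EB[_ cN iN]|] := pselect (E N); last by exists (fun _ _ => True).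
  have : N `*` [set: bool] #<= N.
    by apply: countable_card_le iN; exact: countableX.
  by move=> /card_le_relP[r rP]; exists r.
apply/card_le_relP.
exists (fun x y => exists N, [/\ E N, N x.1, N y & r N x y]); split.
  move=> [x b] [[N EN Nx] _]; have [/(_ (x, b))[//|y Ny rxy] _] := rP _ EN.
  by exists y; [exists N|exists N].
move=> x x' y _ _ [N [EN Nx Ny rxy]] [N' [EN' Nx' Ny' rx'y]].
have NN' : N = N' by apply: tE => //; exists y.
rewrite -{N'}NN' in EN' Nx' Ny' rx'y.
by have [_ rinj] := rP _ EN; apply: rinj rxy rx'y.
Qed.

Lemma card_leU_infinite (T U : Type) (A B : set T) (C : set U) :
  infinite_set C -> A #<= C -> B #<= C -> A `|` B #<= C.
Proof.
move=> infC /card_le_relP[r [rtot rinj]] /card_le_relP[s [stot sinj]].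
apply: card_le_trans (card_le_setXbool infC); apply/card_le_relP.
exists (fun x (y : U * bool) => A x /\ r x y.1 /\ y.2 \/ B x /\ s x y.1 /\ ~~ y.2); split.
  move=> x [Ax|Bx].
    by have [y Cy rxy] := rtot _ Ax; exists (y, true) => //; left.
  by have [y Cy sxy] := stot _ Bx; exists (y, false) => //; right.
move=> x x' [y []] _ _ /= [] [h1 [h2 //]] _ [] [h1' [h2' //]] _.
  exact: rinj h2 h2'.
exact: sinj h2 h2'.
Qed.

(** [Fix] chooses a solution at each point from the values below it. The constraint at [x] reads [f]
    only below [x], so extending the recursive values elsewhere by the default [u0] changes
    nothing. *)
Lemma wf_choice (T U : Type) (u0 : U) (lt : T -> T -> Prop)
    (P : T -> (T -> U) -> U -> Prop) :
  well_founded lt ->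
  (forall x f g u, (forall y, lt y x -> f y = g y) -> P x f u -> P x g u) ->
  (forall x f, (forall y, lt y x -> P y f (f y)) -> exists u, P x f u) ->
  exists f, forall x, P x f (f x).
Proof.
move=> wf Pext Pex.
pose ext x (h : forall y, lt y x -> U) y :=
  if pselect (lt y x) is left yx then h y yx else u0.
pose get (Q : set U) := if pselect (exists u, Q u) is left e then sval (cid e) else u0.
have getP Q : (exists u, Q u) -> Q (get Q).
  by move=> exQ; rewrite /get; case: pselect => // e; exact: svalP (cid e).
pose F x (h : forall y, lt y x -> U) := get [set u | P x (ext x h) u].
pose f := Fix wf (fun _ => U) F.
have fE x : f x = get [set u | P x f u].
  rewrite /f Fix_eq => [|y h h' hh']; last first.
    suff -> : h = h' by [].
    by apply: functional_extensionality_dep => z; apply: functional_extensionality_dep.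
  rewrite /F; congr (get _); apply/seteqP; split=> u; apply: Pext => y yx;
    by rewrite /ext; case: pselect.
exists f => x; elim/(well_founded_ind wf) : x => x IH.
by have [u Pu] := Pex x f IH; rewrite fE; apply: getP; exists u.
Qed.

(** * Well-orders and comparison of cardinals *)

Record strict_well_order (T : Type) (lt : T -> T -> Prop) : Prop := {
  swo_wf : well_founded lt;
  swo_trans : forall x y z, lt x y -> lt y z -> lt x z;
  swo_total : forall x y, [\/ lt x y, x = y | lt y x]
}.

(** [well_order] speaks only of unique minima of nonempty sets. Totality, antisymmetry and
    transitivity come from minima of sets of two or three elements, well-foundedness from the
    minimum of the inaccessible points. *)
Lemma well_order_strict (T : Type) (R : rel T) :
  well_order R -> strict_well_order (fun x y => R x y /\ x <> y).
Proof.
move=> woR.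
have minR (P : T -> Prop) : (exists x, P x) -> exists z,
    [/\ P z, (forall x, P x -> R z x)
      & forall y, P y -> (forall x, P x -> R y x) -> z = y].
  move=> [x Px]; have [|z [[zP zmin] zuniq]] := woR (fun y => `[< P y >]).
    by exists x; apply/asboolP.
  exists z; split; first by move/asboolP : zP.
    by move=> y Py; apply: zmin; apply/asboolP.
  move=> y Py ymin; apply: zuniq; split; first exact/asboolP.
  by move=> t /asboolP; exact: ymin.
have total x y : R x y \/ R y x.
  have [|z [[->|->] zmin _]] := minR (fun z => z = x \/ z = y).
  - by exists x; left.
  - by left; apply: zmin; right.
  - by right; apply: zmin; left.
have refl x : R x x by case: (total x x).
have anti x y : R x y -> R y x -> x = y.
  move=> xy yx; have [|z [_ _ zu]] := minR (fun z => z = x \/ z = y).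
    by exists x; left.
  have zx : z = x by apply: zu; [left|move=> t [->|->]].
  by rewrite -zx; apply: zu; [right|move=> t [->|->]].
have trans x y z : R x y -> R y z -> R x z.
  move=> xy yz; have [|t [tP tmin _]] := minR (fun t => [\/ t = x, t = y | t = z]).
    by exists x; exact: Or31.
  have Rtx : R t x by apply: tmin; exact: Or31.
  have Rty : R t y by apply: tmin; exact: Or32.
  have Rtz : R t z by apply: tmin; exact: Or33.
  case: tP Rtx Rty Rtz => -> // Rx Ry _.
    by rewrite (anti _ _ xy Rx).
  by rewrite -(anti _ _ yz Ry).
split.
- move=> x; apply: contrapT => nAx.
  have [|z [nAz zmin _]] := minR (fun y => ~ Acc (fun x y => R x y /\ x <> y) y).
    by exists x.
  apply: nAz; constructor => y [Ryz yz]; apply: contrapT => nAy.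
  by apply: yz; apply: anti => //; exact: zmin.
- move=> x y z [xy nxy] [yz nyz]; split; first exact: trans yz.
  by move=> xz; apply: nxy; apply: anti => //; rewrite xz.
- move=> x y; have [->|xy] := pselect (x = y); first exact: Or32.
  have [?|?] := total x y; first exact: Or31.
  by apply: Or33; split => // /esym.
Qed.

Lemma ex_strict_well_order (T : Type) :
  exists lt : T -> T -> Prop, strict_well_order lt.
Proof.
have [R /well_order_strict woR] := @well_ordering_principle {classic T}.
by exists (fun x y => R x y /\ x <> y).
Qed.

Lemma wf_min (T : Type) (lt : T -> T -> Prop) (P : T -> Prop) :
  well_founded lt -> (exists x, P x) ->
  exists2 x, P x & forall y, lt y x -> ~ P y.
Proof.
move=> wf [x]; elim/(well_founded_ind wf) : x => x IH Px.
have [[y yx Py]|nP] := pselect (exists2 y, lt y x & P y); first exact: IH Py.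
by exists x => // y yx Py; apply: nP; exists y.
Qed.

Lemma card_le_greedy (T U : Type) (lt : T -> T -> Prop) (A : set T) (B : set U) :
  strict_well_order lt ->
  (forall x, A x -> ~ (B #<= [set y | A y /\ lt y x])) -> A #<= B.
Proof.
move=> wo nB.
(* If [U] is empty, [B] embeds everywhere, so the hypothesis forces [A] to be empty. *)
have [[u0 _]|noU] := pselect (exists u : U, True); last first.
  apply/card_le_relP; exists (fun _ _ => True); split=> x; last first.
    by move=> ? u; case: noU; exists u.
  move=> Ax; case: (nB x Ax); apply/card_le_relP; exists (fun _ _ => True).
  by split=> u; case: noU; exists u.
have [||f fP] := @wf_choice T U u0 lt (fun x f u => A x ->
    B u /\ forall y, A y -> lt y x -> f y <> u) (swo_wf wo).
- move=> x f g u fg + Ax => /(_ Ax)[Bu fu]; split=> // y Ay yx.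
  by rewrite -fg //; exact: fu.
- move=> x f _; have [Ax|] := pselect (A x); last by exists u0.
  apply: contrapT => nex; apply: (nB x Ax).
  apply: card_le_trans (card_image_le f _); apply: subset_card_le => u Bu.
  apply: contrapT => nu; apply: nex; exists u => _; split => // y Ay yx fyu.
  by apply: nu; exists y.
apply/card_le_relP; exists (fun x u => f x = u); split.
  by move=> x /fP[Bfx _]; exists (f x).
move=> x x' u Ax Ax' <- ff; have [xx'|//|x'x] := swo_total wo x x'.
  by case: (fP x' Ax') => _ /(_ x Ax xx')[].
by case: (fP x Ax) => _ /(_ x' Ax' x'x)[].
Qed.

(** The greedy injection of [A] into [B] can only be blocked at an [x] whose predecessors in [A]
    already receive an embedding of [B]. *)
Lemma card_le_total (T U : Type) (A : set T) (B : set U) : A #<= B \/ B #<= A.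
Proof.
have [lt wo] := ex_strict_well_order T.
have [[x Ax Bx]|nB] := pselect (exists2 x, A x & B #<= [set y | A y /\ lt y x]).
  by right; apply: card_le_trans Bx _; apply: subset_card_le => y [].
left; apply: card_le_greedy wo _ => x Ax Bx; apply: nB; by exists x.
Qed.

Lemma smaller_card_le (T : Type) (A B : set T) :
  A #<= B -> smaller B -> smaller A.
Proof. by move=> AB sB TA; apply: sB; exact: card_le_trans AB. Qed.

(** If some initial segment of a well-order is as large as [T], take the least [x] with this
    property and pull the order back along an injection [g] of [T] into the segment below [x]. By
    minimality of [x] the new segments are smaller. *)
Lemma ex_initial_well_order (T : Type) : T -> 
  exists lt : T -> T -> Prop,
    strict_well_order lt /\ forall x, smaller [set y | lt y x].
Proof.
move=> t0; have [lt wo] := ex_strict_well_order T.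
have [[x Px]|nP] := pselect (exists x, [set: T] #<= [set y | lt y x]); last first.
  by exists lt; split=> // x sx; apply: nP; exists x.
have [|{Px}x Px xmin] := @wf_min _ _ (fun x => [set: T] #<= [set y | lt y x])
  (swo_wf wo).
  by exists x.
have /card_le_relP[r [rtot rinj]] := Px.
have /choice[g gP] (y : T) : exists z, lt z x /\ r y z.
  by have [//|z zx yz] := rtot y; exists z.
have ginj y z : g y = g z -> y = z.
  move=> gyz; apply: (rinj _ _ (g y)) => //; first by case: (gP y).
  by rewrite gyz; case: (gP z).
exists (fun y z => lt (g y) (g z)); split.
  split.
  - suff wf z y : g y = z -> Acc (fun y z => lt (g y) (g z)) y.
      by move=> y; exact: wf.
    elim/(well_founded_ind (swo_wf wo)) : z y => z IH y gyz.
    by constructor => t ty; apply: (IH (g t)) => //; rewrite -gyz.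
  - by move=> a b c; exact: swo_trans wo _ _ _.
  - move=> a b; have [ab|ab|ab] := swo_total wo (g a) (g b).
    + exact: Or31.
    + by apply: Or32; exact: ginj.
    + exact: Or33.
move=> y Ty; apply: (xmin (g y)); first by case: (gP y).
apply: card_le_trans Ty _; apply/card_le_relP; exists (fun a b => g a = b); split.
  by move=> a ?; exists (g a).
by move=> a b c _ _ <- /esym/ginj.
Qed.

(* The level function [l] delays the enumeration of [x] until the initial
   segment below [l x] is large enough to have [x] in its layer [A]. *)
Lemma special_enumeration (M : Type) (A : set M -> set M) (S0 : set M) :
  infinite_set S0 -> smaller S0 ->
  (forall S S', smaller S' -> S #<= S' -> A S `<=` A S') ->
  (forall x, exists2 S, smaller S & A S x) ->
  exists (lt : M -> M -> Prop) (L : M -> set M),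
    [/\ strict_well_order lt,
        forall x, [/\ smaller (L x), S0 #<= L x & A (L x) x],
        forall x, [set y | lt y x] #<= L x
      & forall x y, lt y x -> L y `<=` L x].
Proof.
move=> infS0 sS0 Amono Aex.
have [m0 _] := infinite_setN0 infS0.
have [lt [wo slt]] := ex_initial_well_order m0.
have ltxx x : ~ lt x x.
  by elim/(well_founded_ind (swo_wf wo)) : x => x IH xx; exact: (IH x xx xx).
pose I w := [set y | ~ lt w y].
have IE w : I w = [set y | lt y w] `|` [set w].
  apply/seteqP; split=> [y nwy|y [yw|->] wy].
  - by have [|->|] := swo_total wo y w; [left|right|].
  - by apply: (ltxx y); exact: swo_trans wo _ _ _ yw wy.
  - exact: ltxx wy.
have infM : infinite_set [set: M] by apply: sub_infinite_set infS0.
have sI w : smaller (I w).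
  rewrite IE; have [fw|iw] := pselect (finite_set [set y | lt y w]).
    move=> Mfin; apply: infM; apply: card_le_finite Mfin _.
    by rewrite finite_setU; split.
  by apply: smaller_card_le (slt w); apply: card_leU_countable.
have Ile w w' : ~ lt w' w -> I w `<=` I w'.
  move=> ww' y wy w'y; have [yw|yw|//] := swo_total wo y w.
    by apply: ww'; exact: swo_trans wo _ _ _ w'y yw.
  by apply: ww'; rewrite -yw.
(* If [S] embedded in no segment, the greedy recursion would embed all of [M] into [S]. *)
have Iex (S : set M) : smaller S -> exists w, S #<= I w.
  move=> sS; apply: contrapT => nS; apply: sS.
  apply: card_le_greedy wo _ => w _ Sw; apply: nS; exists w.
  by apply: card_le_trans Sw _; apply: subset_card_le; rewrite IE => y [_]; left.
have maxI w w' : exists w'', I w `<=` I w'' /\ I w' `<=` I w''.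
  by have [ww'|->|ww'] := swo_total wo w w'; [exists w'|exists w'|exists w];
   split=> //; apply: Ile => h; apply: (ltxx w); apply: swo_trans wo _ _ _ _ _; eauto.
(* The clause [I w x] places [x] in the segment of its own level, so that all predecessors of [x] in
   the final order lie in [I (l x)]. *)
have /choice[l lP] x : exists w, [/\ S0 #<= I w, A (I w) x & I w x].
  have [S sS ASx] := Aex x.
  have [w1 Sw1] := Iex S sS; have [w2 Sw2] := Iex S0 sS0.
  have [w3 [w13 w23]] := maxI w1 w2; have [w [w3w xw]] := maxI w3 x.
  exists w; split.
  - apply: card_le_trans Sw2 (subset_card_le _).
    exact: subset_trans w3w.
  - apply: Amono ASx => //; apply: card_le_trans Sw1 (subset_card_le _).
    exact: subset_trans w3w.
  - by apply: xw; exact: ltxx.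
(* The order compares levels first, and uses [lt] within one level. *)
exists (fun y x => lt (l y) (l x) \/ l y = l x /\ lt y x), (fun x => I (l x)).
have lex_sub x y : lt (l y) (l x) \/ l y = l x /\ lt y x -> I (l y) `<=` I (l x).
  move=> [yx|[-> _]] //; apply: Ile => xy.
  by apply: (ltxx (l x)); exact: swo_trans wo _ _ _ xy yx.
split.
- split.
  + suff wf w x : l x = w -> Acc (fun y x => lt (l y) (l x) \/ l y = l x /\ lt y x) x.
      by move=> x; exact: wf.
    elim/(well_founded_ind (swo_wf wo)) : w x => w IHw x.
    elim/(well_founded_ind (swo_wf wo)) : x => x IHx lx.
    constructor => y [yx|[lyx yx]]; first by apply: (IHw (l y)) => //; rewrite -lx.
    by apply: IHx => //; rewrite lyx.
  + move=> x y z [xy|[xy xy']] [yz|[yz yz']].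
    * by left; exact: swo_trans wo _ _ _ xy yz.
    * by left; rewrite -yz.
    * by left; rewrite xy.
    * by right; split; [rewrite xy|exact: swo_trans wo _ _ _ xy' yz'].
  + move=> x y; have [xy|xy|xy] := swo_total wo (l x) (l y).
    * by apply: Or31; left.
    * have [xy'|->|xy'] := swo_total wo x y; [|exact: Or32|].
        by apply: Or31; right.
      by apply: Or33; right.
    * by apply: Or33; left.
- by move=> x; have [? ? ?] := lP x.
- move=> x; apply: subset_card_le => y /lex_sub; apply.
  by have [] := lP y.
- by move=> x y /lex_sub.
Qed.

(** * Partial elementary maps *)

Fixpoint rename_term (V W : Type) (f : V -> W) (t : term V) : term W :=
  match t with
  | TVar v => TVar (f v)
  | TOne => TOne W
  | TMul t1 t2 => TMul (rename_term f t1) (rename_term f t2)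
  end.

Fixpoint rename (V : Type) (phi : formula V) : forall W, (V -> W) -> formula W :=
  match phi with
  | FEq t1 t2 => fun W f => FEq (rename_term f t1) (rename_term f t2)
  | FNot phi1 => fun W f => FNot (rename phi1 f)
  | FAnd phi1 phi2 => fun W f => FAnd (rename phi1 f) (rename phi2 f)
  | FEx phi1 => fun W f => FEx (rename phi1 (omap f))
  end.

Lemma eval_rename (M : structure) (V W : Type) (f : V -> W) (e : W -> M) t :
  eval e (rename_term f t) = eval (e \o f) t.
Proof. by elim: t => //= t1 -> t2 ->. Qed.

Lemma sat_rename (M : structure) (V W : Type) (phi : formula V) (f : V -> W)
    (e : W -> M) :
  sat (rename phi f) e <-> sat phi (e \o f).
Proof.
elim: phi W f e => [{}V t1 t2|{}V phi IH|{}V phi1 IH1 phi2 IH2|{}V phi IH] W f e /=.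
- by rewrite !eval_rename.
- by rewrite IH.
- by rewrite IH1 IH2.
- have E a : oapp e a \o omap f = oapp (e \o f) a by apply/funext; case.
  split=> [[a /IH]|[a sa]]; first by rewrite E; exists a.
  by exists a; apply/IH; rewrite E.
Qed.

Lemma term_finite_support (V : Type) (t : term V) :
  exists (F : finType) (g : F -> V) (u : term F),
    forall (M : structure) (e : V -> M), eval e t = eval (e \o g) u.
Proof.
elim: t => [v||t1 [F1 [g1 [u1 E1]]] t2 [F2 [g2 [u2 E2]]]].
- by exists unit, (fun=> v), (TVar tt).
- by exists void, (of_void V), (TOne _).
exists (F1 + F2)%type, (fun x => match x with inl a => g1 a | inr b => g2 b end),
  (TMul (rename_term inl u1) (rename_term inr u2)) => M e /=.
by rewrite E1 E2 !eval_rename.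
Qed.

(** Links formulas over arbitrary variable types, such as parameter sets, to those over ['I_n] in
    [elementary], and gives partial elementarity its finite character along chains. *)
Lemma formula_finite_support (V : Type) (phi : formula V) :
  exists (F : finType) (g : F -> V) (psi : formula F),
    forall (M : structure) (e : V -> M), sat phi e <-> sat psi (e \o g).
Proof.
elim: phi => {V}[V t1 t2|V phi [F [g [psi E]]]|
  V phi1 [F1 [g1 [psi1 E1]]] phi2 [F2 [g2 [psi2 E2]]]|V phi [F [g [psi E]]]].
- have [F1 [g1 [u1 E1]]] := term_finite_support t1.
  have [F2 [g2 [u2 E2]]] := term_finite_support t2.
  exists (F1 + F2)%type, (fun x => match x with inl a => g1 a | inr b => g2 b end),
    (FEq (rename_term inl u1) (rename_term inr u2)) => M e /=.
  by rewrite E1 E2 !eval_rename.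
- by exists F, g, (FNot psi) => M e /=; rewrite E.
- exists (F1 + F2)%type, (fun x => match x with inl a => g1 a | inr b => g2 b end),
    (FAnd (rename psi1 inl) (rename psi2 inr)) => M e /=.
  by rewrite E1 E2 !sat_rename.
(* The new support keeps the indices that name free variables. [insub] sends the discarded ones to
   [None], and they all denote the bound variable. *)
- have /choice[h hP] (j : {j : F | isSome (g j)}) : exists v, g (val j) = Some v.
    by case: j => j /=; case: (g j) => // v _; exists v.
  exists {j : F | isSome (g j)}, h, (FEx (rename psi insub)) => M e /=.
  have Ea a : oapp (e \o h) a \o insub = oapp e a \o g.
    apply/funext => j /=; case: insubP => [k _ <-|]; first by rewrite hP.
    by case: (g j).
  split=> -[a].
    by move=> /E; rewrite -Ea => h'; exists a; apply/sat_rename.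
  by move=> /sat_rename; rewrite Ea => h'; exists a; apply/E.
Qed.

(** Only finitely many variables matter, and [enum_rank] numbers them as [elementary] requires. *)
Lemma sat_elementary (M N : structure) (f : M -> N) (V : Type) (phi : formula V)
    (e : V -> M) :
  elementary f -> (sat phi e <-> sat phi (f \o e)).
Proof.
move=> elf; have [F [g [psi E]]] := formula_finite_support phi.
have := elf _ (rename psi enum_rank) (e \o g \o enum_val).
rewrite !sat_rename !E.
have -> : (e \o g \o enum_val) \o enum_rank = e \o g.
  by apply/funext => j /=; rewrite enum_rankK.
suff -> : (f \o (e \o g \o enum_val)) \o enum_rank = (f \o e) \o g by [].
by apply/funext => j /=; rewrite enum_rankK.
Qed.

Lemma automorphism_elementary (M : structure) (f : M -> M) (V : Type)
    (phi : formula V) (e : V -> M) :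
  automorphism f -> (sat phi e <-> sat phi (f \o e)).
Proof.
move=> [bijf f1 fM]; have injf := bij_inj bijf.
have evalf W (c : W -> M) t : eval (f \o c) t = f (eval c t).
  by elim: t => //= t1 -> t2 ->.
elim: phi e => {V}[V t1 t2|V phi IH|V phi1 IH1 phi2 IH2|V phi IH] e /=.
- by rewrite !evalf; split=> [->|/injf].
- by rewrite IH.
- by rewrite IH1 IH2.
- have E a : f \o oapp e a = oapp (f \o e) (f a) by apply/funext; case.
  split=> [[a /IH]|[b]]; first by rewrite E; exists (f a).
  by case: bijf => g _ fK; rewrite -[b]fK -E => sb; exists (g b); exact/IH.
Qed.

Lemma finite_conjunction (V : Type) (q : set (formula V)) :
  finite_set q -> exists psi : formula V, forall (M : structure) (e : V -> M),
    sat psi e <-> forall phi, q phi -> sat phi e.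
Proof.
move=> /(@finite_seqP {classic formula V})[s ->] {q}.
elim: s => [|phi s [psi E]].
  by exists (FEq (TOne V) (TOne V)) => M e; split=> // _ phi; rewrite /= in_nil.
exists (FAnd phi psi) => M e; split=> /= [[sphi /E sE] chi|h].
  by rewrite in_cons => /orP[/eqP->//|]; exact: sE.
split; first by apply: h; rewrite mem_head.
by apply/E => chi chis; apply: h; rewrite /= in_cons [X in _ || X]chis orbT.
Qed.

(* Tarski-Vaught for the specializing chain. *)
Lemma special_layer_elementary (M : structure) (A : set M -> substructure M) :
  (forall S S', smaller S' -> S #<= S' -> elementary_sub (A S) (A S')) ->
  (forall x : M, exists2 S, smaller S & carrier (A S) x) ->
  forall (V : Type) (phi : formula V) S (e : V -> induced (A S)), smaller S ->
    (sat phi e <-> sat phi (val \o e)).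
Proof.
move=> Ael Aex V phi.
have evalv W S (c : W -> induced (A S)) t : eval (val \o c) t = val (eval c t).
  by elim: t => //= t1 -> t2 ->.
elim: phi => {V}[V t1 t2|V phi IH|V phi1 IH1 phi2 IH2|V phi IH] S e sS.
- by rewrite /= !evalv; split=> [->|/val_inj].
- by rewrite /= IH.
- by rewrite /= IH1// IH2.
- have E S' (c : V -> induced (A S')) a :
      val \o oapp c a = oapp (val \o c) (val a) by apply/funext; case.
  split=> [[a /(IH _ _ sS)]|[a sa]]; first by rewrite E; exists (val a).
  (* The witness [a] may lie outside [A S]. The layer [A S'] lies above [A S] and contains [a], and
     [A S] is elementary in it. *)
  have [S1 sS1 AS1a] := Aex a.
  have [S' [sS' SS' S1S']] : exists S' : set M,
      [/\ smaller S', S #<= S' & S1 #<= S'].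
    by have [?|?] := card_le_total S S1; [exists S1|exists S]; split;
      rewrite ?card_lexx.
  have [AA elAA] := Ael _ _ sS' SS'; have [A1 _] := Ael _ _ sS' S1S'.
  apply/(sat_elementary _ _ elAA).
  exists (exist _ a (mem_set (A1 _ AS1a)) : induced (A S')).
  by apply/(IH _ _ sS'); rewrite E.
Qed.

(** The graph of a partial elementary map, kept as a set of pairs so that swapping exchanges the
    forth and back steps. Single-valuedness and injectivity are the case of the formula for
    equality. *)
Definition partial_elementary (M : structure) (H : set (M * M)) : Prop :=
  forall (V : Type) (phi : formula V) (e : V -> M * M), (forall v, H (e v)) ->
    (sat phi (fst \o e) <-> sat phi (snd \o e)).

Lemma partial_elementary_inj (M : structure) (H : set (M * M)) z z' :
  partial_elementary H -> H z -> H z' -> (z.1 = z'.1 <-> z.2 = z'.2).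
Proof.
move=> elH Hz Hz'.
have := elH bool (FEq (TVar true) (TVar false)) (fun b => if b then z else z').
by apply; case.
Qed.

Lemma partial_elementary_swap (M : structure) (H : set (M * M)) :
  partial_elementary H -> partial_elementary [set z | H (z.2, z.1)].
Proof.
move=> elH V phi e He; have := elH _ phi (fun v => ((e v).2, (e v).1)) He.
by move=> h; split=> /h.
Qed.

Lemma partial_elementary_sub (M : structure) (H H' : set (M * M)) :
  H `<=` H' -> partial_elementary H' -> partial_elementary H.
Proof. by move=> HH' elH' V phi e He; apply: elH' => v; exact: HH'. Qed.

(** A formula involves finitely many pairs, and in a chain these already lie in a single member. *)
Lemma partial_elementary_bigcup (M : structure) (F : set (set (M * M))) :
  F !=set0 -> total_on F subset -> (forall H, F H -> partial_elementary H) ->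
  partial_elementary (\bigcup_(H in F) H).
Proof.
move=> [H0 FH0] totF elF V phi e He.
have [I [g [psi E]]] := formula_finite_support phi; rewrite !E.
have [H FH HI] : exists2 H, F H & forall j, H (e (g j)).
  suff [H FH Hs] : exists2 H, F H & forall j, j \in enum I -> H (e (g j)).
    by exists H => // j; apply: Hs; rewrite mem_enum.
  elim: (enum I) => [|j s [H FH Hs]]; first by exists H0.
  have [H' FH' H'j] := He (g j).
  have [HH'|H'H] := totF _ _ FH FH'; [exists H'|exists H] => // k;
    by rewrite in_cons => /orP[/eqP->|/Hs] //; first [exact: HH'|exact: H'H].
exact: (elF _ FH _ psi (e \o g)).
Qed.

(** The type of [x] over the domain of [H], with parameters moved along [H] to its range, is
    realized by saturation of [A]. The range supplies the parameters, hence the bound on its size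
    and its inclusion in [A]. *)
Lemma partial_elementary_extend (M : structure) (A : substructure M)
    (L : set M) (H : set (M * M)) (x : M) :
  (forall (V : Type) (phi : formula V) (e : V -> induced A),
     sat phi e <-> sat phi (val \o e)) ->
  succ_saturated L (induced A) ->
  partial_elementary H -> (forall z, H z -> carrier A z.2) ->
  [set z.2 | z in H] #<= L ->
  exists2 u, carrier A u & partial_elementary (H `|` [set (x, u)]).
Proof.
move=> elA satA elH HA HL.
pose B := [set b : induced A | exists a, H (a, val b)].
have BL : B #<= L.
  apply: card_le_trans HL; apply/card_le_relP.
  exists (fun b y => val b = y); split.
    by move=> b [a Hab]; exists (val b) => //; exists (a, val b).
  by move=> b b' y _ _ <- /val_inj.
have /choice[g gP] (b : B) : exists a, H (a, val (val b)) by exact: (set_valP b).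
pose p := [set phi : formula (option B) | sat phi (oapp g x)].
have [|a aP] := satA B BL p.
  (* A finite part of [p] amounts to one formula [psi]. Its existential closure holds in [M] on the
     domain side, passes along [H] to the range side, and then down to [A] by elementarity. *)
  move=> q finq qp; have [psi E] := finite_conjunction finq.
  have : sat (FEx psi) g by exists x; apply/E => phi /qp.
  move=> /(elH _ (FEx psi) (fun b => (g b, val (val b))) gP).
  move=> /(elA _ (FEx psi) (fun b : B => val b))[a /E aP].
  by exists a.
exists (val a); first exact: set_valP.
move=> V phi e He.
(* Each pair is either in [H], and then named by a parameter, or the new pair, named by [None]. *)
have /choice[k kP] v : exists b : option B,
    (e v).1 = oapp g x b /\ (e v).2 = oapp (fun b : B => val (val b)) (val a) b.
  case: (He v) => [Hev|->]; last by exists None.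
  have Be : B (exist _ (e v).2 (mem_set (HA _ Hev)) : induced A).
    by exists (e v).1; rewrite -surjective_pairing.
  exists (Some (SigSub (mem_set Be) : B)); split => //=.
  by apply/(partial_elementary_inj elH Hev (gP _)).
have -> : fst \o e = oapp g x \o k by apply/funext => v /=; case: (kP v).
have -> : snd \o e = (val \o oapp (fun b : B => val b) a) \o k.
  by apply/funext => v /=; case: (kP v) => _ ->; case: (k v).
rewrite -[X in X <-> _]sat_rename -[X in _ <-> X]sat_rename -elA.
split; first exact: aP.
(* The type [p] is complete: a formula outside it has its negation in it. *)
by move=> sk; apply: contrapT => nsk; exact: (aP (FNot (rename phi k)) nsk).
Qed.

(** * Homogeneity of special structures *)

Lemma partial_elementary_automorphism (M : structure) (H : set (M * M))
    (f g : M -> M) :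
  partial_elementary H -> (forall x, H (x, f x)) -> (forall x, H (g x, x)) ->
  automorphism f.
Proof.
move=> elH Hf Hg; split.
- exists g => x.
    by apply/(partial_elementary_inj elH (Hg _) (Hf _)).
  by apply/(partial_elementary_inj elH (Hf _) (Hg _)).
- have := elH unit (FEq (TVar tt) (TOne _)) (fun=> (one, f one)).
  by move=> /(_ (fun=> Hf _))[+ _]; apply.
- move=> x y; pose e (i : option bool) :=
    match i with None => mul x y | Some true => x | Some false => y end.
  have := elH _ (FEq (TVar None) (TMul (TVar (Some true)) (TVar (Some false))))
    (fun i => (e i, f (e i))).
  by move=> /(_ (fun=> Hf _))[+ _]; apply.
Qed.

Lemma special_homogeneous (M : structure) (S0 : set M) (a b : M) :
  special M -> infinite_set S0 -> smaller S0 ->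
  partial_elementary [set (a, b)] ->
  exists2 f : M -> M, automorphism f & f a = b.
Proof.
move=> [A [Ael Asat Aex]] infS0 sS0 elab.
have Amono S S' : smaller S' -> S #<= S' -> carrier (A S) `<=` carrier (A S').
  by move=> sS' SS'; have [] := Ael _ _ sS' SS'.
(* [S1] serves as the least level: it is infinite because [S0] is, and every [L x] dominates it, so
   [a] and [b] lie in all layers used. *)
have [S1 [sS1 S01 [AS1a AS1b]]] : exists S1 : set M, [/\ smaller S1, S0 #<= S1
    & carrier (A S1) a /\ carrier (A S1) b].
  have max2 (S S' : set M) : smaller S -> smaller S' ->
      exists S'' : set M, [/\ smaller S'', S #<= S'' & S' #<= S''].
    by move=> ? ?; have [?|?] := card_le_total S S'; [exists S'|exists S];
      rewrite card_lexx.
  have [Sa sSa ASa] := Aex a; have [Sb sSb ASb] := Aex b.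
  have [S1 [sS1 ? ?]] := max2 _ _ sSa sSb; have [S2 [sS2 ? ?]] := max2 _ _ sS0 sS1.
  exists S2; split=> //; split.
    by apply: Amono ASa => //; apply: (@card_le_trans _ _ _ S1).
  by apply: Amono ASb => //; apply: (@card_le_trans _ _ _ S1).
have infS1 : infinite_set S1 by move=> fS1; apply: infS0; exact: card_le_finite fS1.
have [lt [L [wo LP ltL Lmono]]] := special_enumeration infS1 sS1 Amono Aex.
have infL x : infinite_set (L x).
  by move=> fL; apply: infS1; have [_ SL _] := LP x; exact: card_le_finite fL.
(* Besides [(a, b)], each [y] in [Q] contributes two pairs: [y] with its image [(f y).1], and [y]
   with its preimage [(f y).2]. *)
pose stage (f : M -> M * M) (Q : set M) : set (M * M) := [set (a, b)] `|`
  [set z | exists2 y, Q y & z = (y, (f y).1) \/ z = ((f y).2, y)].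
pose le y x := lt y x \/ y = x.
pose good x f (u : M * M) := [/\ carrier (A (L x)) u.1, carrier (A (L x)) u.2
  & partial_elementary (stage f (lt^~ x) `|` [set (x, u.1)] `|` [set (u.2, x)])].
(* The stage over a downward closed [Q] is the union of the chain of stages up to and including some
   [y] in [Q], and [good y] makes the link at [y] elementary. The singleton of [(a, b)] keeps the
   chain nonempty when [Q] is empty. *)
have el_stage f (Q : set M) : (forall x y, Q x -> lt y x -> Q y) ->
    (forall y, Q y -> good y f (f y)) -> partial_elementary (stage f Q).
  move=> Qdown Qgood.
  pose F := [set [set (a, b)]] `|` [set stage f (le^~ y) | y in Q].
  apply: (@partial_elementary_sub _ _ (\bigcup_(H in F) H)).
    move=> z [zab|[y Qy zy]]; first by exists [set (a, b)] => //; left.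
    exists (stage f (le^~ y)); first by right; exists y.
    by right; exists y => //; right.
  apply: partial_elementary_bigcup.
  - by exists [set (a, b)]; left.
  - have sub y y' : lt y y' -> stage f (le^~ y) `<=` stage f (le^~ y').
      move=> yy' z [|[t ty zt]]; [by left|right; exists t => //; left].
      by case: ty => [ty|->//]; exact: swo_trans wo _ _ _ ty yy'.
    move=> _ _ [->|[y Qy <-]] [->|[y' Qy' <-]]; [by left|left|right|].
    + by move=> z; left.
    + by move=> z; left.
    + have [/sub|->|/sub] := swo_total wo y y'; [by left|by left|by right].
  - move=> _ [->//|[y /Qgood[_ _ gy] <-]].
    apply: partial_elementary_sub gy => z [|[t [ty|->]]].
    + by left; left; left.
    + by left; left; right; exists t.
    + by case=> ->; [left; right|right].
have [||f fP] := @wf_choice M (M * M) (a, b) lt good (swo_wf wo).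
- move=> x f g u fg [Au Av el]; split => //.
  apply: partial_elementary_sub el => z [[[|[y yx zy]]|]|].
  + by left; left; left.
  + by left; left; right; exists y => //; rewrite fg.
  + by left; right.
  + by right.
- move=> x f IH; have elH : partial_elementary (stage f (lt^~ x)).
    apply: el_stage => // y z yx zy; exact: swo_trans wo _ _ _ zy yx.
  have [sLx S1L Ax] := LP x.
  have elA V (phi : formula V) (e : V -> induced (A (L x))) :
      sat phi e <-> sat phi (val \o e).
    exact: (special_layer_elementary Ael Aex).
  have AA y : lt y x -> carrier (A (L y)) `<=` carrier (A (L x)).
    by move=> yx; apply: Amono => //; apply: subset_card_le; exact: Lmono.
  have HA z : stage f (lt^~ x) z -> carrier (A (L x)) z.1 /\ carrier (A (L x)) z.2.
    move=> [->|[y yx zy]]; first by split; apply: (Amono S1).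
    have [_ _ Ay] := LP y; have [f1 f2 _] := IH _ yx.
    by case: zy => ->; split; apply: (AA y).
  (* There are two pairs for each predecessor of [x], besides [(a, b)], and the predecessors number
     at most as many as [L x], which is infinite. *)
  have HL (p : M * M -> M) : (p = fst \/ p = snd) ->
      [set p z | z in stage f (lt^~ x)] #<= L x.
    move=> pE; apply: (@card_le_trans _ _ _ ([set p (a, b)] `|`
      ([set p (y, (f y).1) | y in [set y | lt y x]] `|`
       [set p ((f y).2, y) | y in [set y | lt y x]]))).
      apply: subset_card_le => _ [z + <-] => -[->|[y yx [->|->]]].
      + by left.
      + by right; left; exists y.
      + by right; right; exists y.
    apply: card_leU_infinite => //.
      by apply: countable_card_le.
    by apply: card_leU_infinite => //; apply: card_le_trans (card_image_le _ _) (ltL x).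
  (* The forth step finds an image [u] of [x]. The back step applies the same lemma to the swapped
     relation, whose range contains [x]; this is where [x] has to lie in its own layer. *)
  have [u Au elu] := partial_elementary_extend x elA (Asat _ sLx) elH
    (fun z Hz => (HA z Hz).2) (HL snd (or_intror erefl)).
  have := partial_elementary_extend x elA (Asat _ sLx) (partial_elementary_swap elu).
  case.
  + by move=> z [/HA[]|[-> _]].
  + apply: (@card_le_trans _ _ _ ([set fst z | z in stage f (lt^~ x)] `|` [set x])).
      apply: subset_card_le => _ [z + <-] => -[Hz|[-> _]]; last by right.
      by left; exists (z.2, z.1).
    apply: card_leU_infinite => //; first exact: (HL fst (or_introl erefl)).
    exact: countable_card_le.
  move=> v Av elv; exists (u, v); split=> //=.
  apply: partial_elementary_sub (partial_elementary_swap elv).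
  by move=> [z1 z2] [[|[-> ->]]|[-> ->]] /=; [left; left|left; right|right].
have elf : partial_elementary (stage f setT) by apply: el_stage.
exists (fun x => (f x).1).
  apply: (partial_elementary_automorphism (g := fun x => (f x).2) elf) => x.
    by right; exists x => //; left.
  by right; exists x => //; right.
have Hab : stage f setT (a, b) by left.
have Haf : stage f setT (a, (f a).1) by right; exists a => //; left.
by apply/(partial_elementary_inj elf Haf Hab).
Qed.

(** * Primary parts *)

Definition divides (M : structure) (d x : M) : Prop := exists c, x = mul d c.

(** Every divisor of [x] other than 1 is divisible by [p]: a first-order substitute for being a
    power of [p]. The negated existential matches the connectives of [formula]. *)
Definition primary (M : structure) (p x : M) : Prop :=
  ~ exists d e, x = mul d e /\ d <> one /\ ~ divides p d.

(* [e v] and [e w] play the roles of [p] and [x]; the formulas are chosen so that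
   [sat] reduces to the predicates above by computation. *)
Definition divides_formula (V : Type) (v w : V) : formula V :=
  FEx (FEq (TVar (Some w)) (TMul (TVar (Some v)) (TVar None))).

Definition primary_formula (V : Type) (v w : V) : formula V :=
  FNot (FEx (FEx (FAnd
    (FEq (TVar (Some (Some w))) (TMul (TVar (Some None)) (TVar None)))
    (FAnd (FNot (FEq (TVar (Some None)) (TOne _)))
          (FNot (divides_formula (Some (Some v)) (Some None))))))).

Record comm_monoid (M : structure) : Prop := {
  cm_mulC : forall x y : M, mul x y = mul y x;
  cm_mulA : forall x y z : M, mul x (mul y z) = mul (mul x y) z;
  cm_mul1 : forall x : M, mul one x = x
}.

(* [p] is a prime at which every element has a unique factorization into a
   [p]-primary and a [p]-free part. *)
Record splitting (M : structure) (p : M) : Prop := {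
  sp_ex : forall x, exists y z, x = mul y z /\ primary p y /\ ~ divides p z;
  sp_uniq : forall y z y' z', mul y z = mul y' z' -> primary p y ->
    primary p y' -> ~ divides p z -> ~ divides p z' -> y = y' /\ z = z';
  sp_primaryM : forall y y', primary p y -> primary p y' -> primary p (mul y y');
  sp_primary1 : primary p one;
  sp_primary : primary p p;
  sp_freeM : forall z z', ~ divides p z -> ~ divides p z' ->
    ~ divides p (mul z z');
  sp_free1 : ~ divides p one
}.

Definition orthogonal (M : structure) (p q : M) : Prop :=
  forall y, primary p y -> ~ divides q y.

(** * Transfer of first-order properties to an elementary extension *)

Lemma elementary_comm_monoid (M N : structure) (i : M -> N) :
  elementary i -> comm_monoid M -> comm_monoid N.
Proof.
move=> eli [mC mA m1].
(* A failure of a law in [N] is an existential sentence, which [tr] reflects to [M], where the law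
   holds. *)
have tr (phi : formula void) : sat phi (i \o of_void M) -> sat phi (of_void M).
  by move=> h; apply/(sat_elementary _ _ eli).
split.
- move=> x y; apply: contrapT => h.
  have [|a [b]] := tr (FEx (FEx (FNot (FEq
    (TMul (TVar (Some None)) (TVar None)) (TMul (TVar None) (TVar (Some None))))))).
    by exists x, y.
  by apply; exact: mC.
- move=> x y z; apply: contrapT => h.
  have [|a [b [c]]] := tr (FEx (FEx (FEx (FNot (FEq
    (TMul (TVar (Some (Some None))) (TMul (TVar (Some None)) (TVar None)))
    (TMul (TMul (TVar (Some (Some None))) (TVar (Some None))) (TVar None))))))).
    by exists x, y, z.
  by apply; exact: mA.
- move=> x; apply: contrapT => h.
  have [|a] := tr (FEx (FNot (FEq (TMul (TOne _) (TVar None)) (TVar None)))).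
    by exists x.
  by apply; exact: m1.
Qed.

Lemma elementary_splitting (M N : structure) (i : M -> N) (p : M) :
  elementary i -> splitting p -> splitting (i p).
Proof.
move=> eli [sex suniq spM sp1 spp sfM sf1].
have tr (phi : formula unit) : sat phi (i \o (fun=> p)) -> sat phi (fun=> p).
  by move=> h; apply/(sat_elementary _ _ eli).
split.
- move=> x; apply: contrapT => h.
  have [|a] := tr (FEx (FNot (FEx (FEx (FAnd
    (FEq (TVar (Some (Some None))) (TMul (TVar (Some None)) (TVar None)))
    (FAnd (primary_formula (Some (Some (Some tt))) (Some None))
          (FNot (divides_formula (Some (Some (Some tt))) None)))))))).
    by exists x.
  by apply; exact: sex.
- move=> y z y' z' yz py py' fz fz'; apply: contrapT => h.
  have [|a [b [a' [b' [e [pa [pa' [fb [fb' []]]]]]]]]] :=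
    tr (FEx (FEx (FEx (FEx (FAnd
    (FEq (TMul (TVar (Some (Some (Some None)))) (TVar (Some (Some None))))
         (TMul (TVar (Some None)) (TVar None)))
    (FAnd (primary_formula (Some (Some (Some (Some tt)))) (Some (Some (Some None))))
    (FAnd (primary_formula (Some (Some (Some (Some tt)))) (Some None))
    (FAnd (FNot (divides_formula (Some (Some (Some (Some tt)))) (Some (Some None))))
    (FAnd (FNot (divides_formula (Some (Some (Some (Some tt)))) None))
    (FNot (FAnd (FEq (TVar (Some (Some (Some None)))) (TVar (Some None)))
                (FEq (TVar (Some (Some None))) (TVar None))))))))))))).
    by exists y, z, y', z'.
  exact: suniq.
- move=> y y' py py'; apply: contrapT => h.
  (* [primary_formula] takes variables rather than terms, so the product is named by a further
     quantified variable. *)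
  have [|a [a' [b [E [pa [pa' []]]]]]] := tr (FEx (FEx (FEx (FAnd
    (FEq (TVar None) (TMul (TVar (Some (Some None))) (TVar (Some None))))
    (FAnd (primary_formula (Some (Some (Some tt))) (Some (Some None)))
    (FAnd (primary_formula (Some (Some (Some tt))) (Some None))
          (FNot (primary_formula (Some (Some (Some tt))) None)))))))).
    by exists y, y', (mul y y').
  suff : primary p (mul a a') by rewrite -(E : b = mul a a').
  exact: spM.
- apply: contrapT => h.
  have [|a [E []]] := tr (FEx (FAnd (FEq (TVar None) (TOne _))
    (FNot (primary_formula (Some tt) None)))).
    by exists one.
  by move: sp1; rewrite -(E : a = one).
- by apply/(sat_elementary (primary_formula tt tt) (fun=> p) eli).
- move=> z z' fz fz' h.
  have [|a [a' [b [E [fa [fa' db]]]]]] := tr (FEx (FEx (FEx (FAnd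
    (FEq (TVar None) (TMul (TVar (Some (Some None))) (TVar (Some None))))
    (FAnd (FNot (divides_formula (Some (Some (Some tt))) (Some (Some None))))
    (FAnd (FNot (divides_formula (Some (Some (Some tt))) (Some None)))
          (divides_formula (Some (Some (Some tt))) None))))))).
    by exists z, z', (mul z z').
  by apply: (sfM a a' fa fa'); rewrite -(E : b = mul a a').
- move=> h.
  have [|a [E da]] := tr (FEx (FAnd (FEq (TVar None) (TOne _))
    (divides_formula (Some tt) None))).
    by exists one.
  by apply: sf1; rewrite -(E : a = one).
Qed.

Lemma elementary_orthogonal (M N : structure) (i : M -> N) (p q : M) :
  elementary i -> orthogonal p q -> orthogonal (i p) (i q).
Proof.
move=> eli pq y py qy.
have [|a [pa qa]] := proj2 (sat_elementary (FEx (FAnd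
    (primary_formula (Some true) None) (divides_formula (Some false) None)))
  (fun b : bool => if b then p else q) eli).
  by exists y.
exact: pq pa qa.
Qed.

Definition primary_part (M : structure) (p x : M) : M :=
  xget (one : {classic M})
    [set y | exists z, x = mul y z /\ primary p y /\ ~ divides p z].

Definition free_part (M : structure) (p x : M) : M :=
  xget (one : {classic M})
    [set z | exists y, x = mul y z /\ primary p y /\ ~ divides p z].

(** * Primary and free parts, and the swap of two primary parts *)

Section Swap.

Variables (M : structure) (cM : comm_monoid M).

Let mC := cm_mulC cM.
Let mA := cm_mulA cM.
Let m1 := cm_mul1 cM.

Lemma cm_mulr1 (x : M) : mul x one = x.
Proof. by rewrite mC m1. Qed.

Lemma cm_mulACA (x y z t : M) :
  mul (mul x y) (mul z t) = mul (mul x z) (mul y t).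
Proof. by rewrite -!mA; congr mul; rewrite !mA (mC y). Qed.

Lemma divides_refl (p : M) : divides p p.
Proof. by exists one; rewrite cm_mulr1. Qed.

Lemma divides_mull (p x y : M) : divides p y -> divides p (mul x y).
Proof. by move=> [c ->]; exists (mul x c); rewrite mC -mA (mC c). Qed.

(** The two parts are chosen separately, each with its own cofactor. Uniqueness of the factorization
    shows that they belong together. *)
Lemma primary_partP (p x : M) : splitting p ->
  [/\ x = mul (primary_part p x) (free_part p x),
      primary p (primary_part p x) & ~ divides p (free_part p x)].
Proof.
move=> sp; have [y [z [E [py fz]]]] := sp_ex sp x.
have [z' [E' [py' fz']]] : exists z, x = mul (primary_part p x) z /\
    primary p (primary_part p x) /\ ~ divides p z.
  exact: (@xgetPex {classic M} one
    [set y | exists z, x = mul y z /\ primary p y /\ ~ divides p z]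
    (ex_intro _ y (ex_intro _ z _))).
have [y'' [E'' [py'' fz'']]] : exists y, x = mul y (free_part p x) /\
    primary p y /\ ~ divides p (free_part p x).
  exact: (@xgetPex {classic M} one
    [set z | exists y, x = mul y z /\ primary p y /\ ~ divides p z]
    (ex_intro _ z (ex_intro _ y _))).
split=> //; rewrite {1}E'; congr mul.
by have [] := sp_uniq sp (esym (etrans (esym E'') E')).
Qed.

Lemma partsE (p y z : M) : splitting p -> primary p y -> ~ divides p z ->
  primary_part p (mul y z) = y /\ free_part p (mul y z) = z.
Proof.
move=> sp py fz; have [E py' fz'] := primary_partP (mul y z) sp.
by have [] := sp_uniq sp (esym E).
Qed.

Lemma primary_part_id (p y : M) : splitting p -> primary p y ->
  primary_part p y = y.
Proof.
move=> sp py; have [] := partsE sp py (sp_free1 sp).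
by rewrite cm_mulr1.
Qed.

Lemma free_part_primary (p y : M) : splitting p -> primary p y ->
  free_part p y = one.
Proof.
move=> sp py; have [] := partsE sp py (sp_free1 sp).
by rewrite cm_mulr1.
Qed.

Lemma primary_part_free (p z : M) : splitting p -> ~ divides p z ->
  primary_part p z = one.
Proof. by move=> sp fz; have [] := partsE sp (sp_primary1 sp) fz; rewrite m1. Qed.

Lemma partsM (p x y : M) : splitting p ->
  primary_part p (mul x y) = mul (primary_part p x) (primary_part p y) /\
  free_part p (mul x y) = mul (free_part p x) (free_part p y).
Proof.
move=> sp; have [Ex px fx] := primary_partP x sp.
have [Ey py fy] := primary_partP y sp.
rewrite {1 3}Ex {1 3}Ey cm_mulACA; apply: partsE => //.
  exact: sp_primaryM.
exact: sp_freeM.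
Qed.

Definition monoid_morphism (f : M -> M) : Prop :=
  f one = one /\ forall x y, f (mul x y) = mul (f x) (f y).

(** Total maps accommodate both the exponent map between two primes of the standard model and an
    automorphism taken on its primary elements. *)
Record primary_iso (p r : M) (f f' : M -> M) : Prop := {
  pi_morph : monoid_morphism f;
  pi_morph' : monoid_morphism f';
  pi_primary : forall x, primary p x -> primary r (f x);
  pi_primary' : forall x, primary r x -> primary p (f' x);
  pi_K : forall x, primary p x -> f' (f x) = x;
  pi_K' : forall x, primary r x -> f (f' x) = x
}.

Record coprime_splittings (p r : M) : Prop := {
  cs_l : splitting p;
  cs_r : splitting r;
  cs_lr : orthogonal p r;
  cs_rl : orthogonal r p
}.

(** [f] turns the [p]-part into the new [r]-part, [f'] turns the [r]-part into the new [p]-part, and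
    the factor free of both is kept. *)
Definition swap (p r : M) (f f' : M -> M) (x : M) : M :=
  mul (mul (f (primary_part p x)) (f' (primary_part r x)))
      (free_part r (free_part p x)).

(** Removing the [p]-part does not change the [r]-part, because [p]-primary elements are free of
    [r]. *)
Lemma coprime_decomposition (p r x : M) : coprime_splittings p r ->
  x = mul (mul (primary_part p x) (primary_part r x))
          (free_part r (free_part p x)).
Proof.
move=> [sp sr pr rp]; have [Ex px fx] := primary_partP x sp.
rewrite {1}Ex -mA; congr mul; have [Ey _ _] := primary_partP (free_part p x) sr.
rewrite {1}Ey; congr mul.
rewrite {2}Ex (partsM _ _ sr).1.
by rewrite (primary_part_free sr (pr _ px)) m1.
Qed.

Lemma coprime_free_part (p r x : M) : coprime_splittings p r ->
  ~ divides p (free_part r (free_part p x)) /\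
  ~ divides r (free_part r (free_part p x)).
Proof.
move=> [sp sr pr rp]; have [_ _ fx] := primary_partP x sp.
have [Ey _ fy] := primary_partP (free_part p x) sr.
by split=> // h; apply: fx; rewrite Ey; exact: divides_mull.
Qed.

Section SwapTheory.

Variables (p r : M) (f f' : M -> M).
Hypotheses (cpr : coprime_splittings p r) (ff' : primary_iso p r f f').

Let sp := cs_l cpr.
Let sr := cs_r cpr.
Let pr := cs_lr cpr.
Let rp := cs_rl cpr.

Let pf x : primary r (f (primary_part p x)).
Proof. by apply: (pi_primary ff'); have [] := primary_partP x sp. Qed.

Let pf' x : primary p (f' (primary_part r x)).
Proof. by apply: (pi_primary' ff'); have [] := primary_partP x sr. Qed.

Lemma swap_primary_part_l x :
  primary_part p (swap p r f f' x) = f' (primary_part r x).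
Proof.
have [fp fr] := coprime_free_part x cpr.
rewrite /swap !(partsM _ _ sp).1 (primary_part_free sp (rp (@pf x))) m1.
by rewrite (primary_part_id sp (@pf' x)) (primary_part_free sp fp) cm_mulr1.
Qed.

Lemma swap_primary_part_r x :
  primary_part r (swap p r f f' x) = f (primary_part p x).
Proof.
have [fp fr] := coprime_free_part x cpr.
rewrite /swap !(partsM _ _ sr).1 (primary_part_id sr (@pf x)).
by rewrite (primary_part_free sr (pr (@pf' x))) (primary_part_free sr fr) !cm_mulr1.
Qed.

(** The factors at [p] and [r], both in [x] and in its swap, are free of [q], so each [q]-part comes
    from the common third factor. *)
Lemma swap_primary_part_other q x : splitting q -> orthogonal p q ->
  orthogonal r q -> primary_part q (swap p r f f' x) = primary_part q x.
Proof.
move=> sq pq rq; have [_ px _] := primary_partP x sp.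
have [_ rx _] := primary_partP x sr.
rewrite [in RHS](coprime_decomposition x cpr) /swap !(partsM _ _ sq).1.
rewrite (primary_part_free sq (rq _ (@pf x))) (primary_part_free sq (pq _ (@pf' x))).
by rewrite (primary_part_free sq (pq _ px)) (primary_part_free sq (rq _ rx)).
Qed.

Lemma swap_free_part x : free_part r (free_part p (swap p r f f' x)) =
  free_part r (free_part p x).
Proof.
have [fp fr] := coprime_free_part x cpr.
have free_partE (q z : M) : splitting q -> ~ divides q z -> free_part q z = z.
  by move=> sq fz; have [_] := partsE sq (sp_primary1 sq) fz; rewrite m1.
rewrite /swap !(partsM _ _ sp).2 (free_part_primary sp (@pf' x)) cm_mulr1.
rewrite (free_partE p _ sp fp) (free_partE p _ sp (rp (@pf x))).
by rewrite (partsM _ _ sr).2 (free_part_primary sr (@pf x)) m1 free_partE.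
Qed.

Lemma swapK : cancel (swap p r f f') (swap p r f f').
Proof.
move=> x; have [_ px _] := primary_partP x sp; have [_ rx _] := primary_partP x sr.
rewrite {1}/swap swap_primary_part_l swap_primary_part_r swap_free_part.
rewrite (pi_K ff' px) (pi_K' ff' rx) (mC (primary_part r x)).
by rewrite -coprime_decomposition.
Qed.

(** Under this equation the swap merely permutes the first two factors of the decomposition of
    [x]. *)
Lemma swap_fix x : primary_part r x = f (primary_part p x) ->
  swap p r f f' x = x.
Proof.
have [_ px _] := primary_partP x sp.
move=> E; rewrite /swap E (pi_K ff' px) -E (mC (primary_part r x)).
by rewrite -coprime_decomposition.
Qed.

Lemma swap_automorphism : automorphism (swap p r f f').
Proof.
split; first by exists (swap p r f f'); exact: swapK.
  apply: swap_fix; rewrite (primary_part_id sr (sp_primary1 sr)).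
  by rewrite (primary_part_id sp (sp_primary1 sp)) (pi_morph ff').1.
move=> x y; rewrite /swap (partsM x y sp).1 (partsM x y sr).1 (partsM x y sp).2.
rewrite (partsM _ _ sr).2 (pi_morph ff').2 (pi_morph' ff').2.
by rewrite [X in mul X _ = _]cm_mulACA cm_mulACA.
Qed.

Lemma swap_primary x : primary p x -> swap p r f f' x = f x.
Proof.
move=> px; rewrite /swap (primary_part_id sp px) (free_part_primary sp px).
rewrite (primary_part_free sr (pr px)) (pi_morph' ff').1 cm_mulr1.
by rewrite (free_part_primary sr (sp_primary1 sr)) cm_mulr1.
Qed.

Lemma swap_orthogonal q x : primary q x -> orthogonal q p -> orthogonal q r ->
  swap p r f f' x = x.
Proof.
move=> qx qp qr; apply: swap_fix.
rewrite (primary_part_free sr (qr _ qx)) (primary_part_free sp (qp _ qx)).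
by rewrite (pi_morph ff').1.
Qed.

End SwapTheory.

Lemma automorphism_primary (f : M -> M) (p x : M) :
  automorphism f -> primary p x -> primary (f p) (f x).
Proof.
move=> /automorphism_elementary fel.
by move=> /(fel _ (primary_formula true false) (fun b => if b then p else x)).
Qed.

Lemma automorphism_inv (f g : M -> M) :
  automorphism f -> cancel f g -> cancel g f -> automorphism g.
Proof.
move=> [bijf f1 fM] fK gK; split; first by exists f.
  by rewrite -f1 fK.
by move=> x y; rewrite -{1}[x]gK -{1}[y]gK -fM fK.
Qed.

(** Being primary is definable from the prime, so [f] and its inverse carry the [p]-primary and
    [r]-primary elements onto each other. *)
Lemma automorphism_primary_iso (f : M -> M) (p r : M) :
  automorphism f -> f p = r -> exists g, primary_iso p r f g.
Proof.
move=> autf fp; have [[g fK gK] f1 fM] := autf.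
have autg := automorphism_inv autf fK gK; have [_ g1 gM] := autg.
exists g; split=> // [x /(automorphism_primary autf)|x /(automorphism_primary autg)].
  by rewrite fp.
by rewrite -fp fK.
Qed.

End Swap.

(** * The standard model *)

Local Notation PN := posnat_structure.

Definition to_posnat (n : nat) (n_gt0 : 0 < n) : PN := exist _ n n_gt0.

Lemma posnat_val_inj (x y : PN) : sval x = sval y -> x = y.
Proof. exact: val_inj. Qed.

Lemma posnat_gt0 (x : PN) : 0 < sval x.
Proof. exact: valP x. Qed.

Lemma posnat_comm_monoid : comm_monoid PN.
Proof.
split=> [x y|x y z|x]; apply: posnat_val_inj => /=.
- exact: mulnC.
- exact: mulnA.
- exact: mul1n.
Qed.

Lemma posnat_divides (d x : PN) : divides d x <-> sval d %| sval x.
Proof.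
split=> [[c ->]|/dvdnP[k xkd]]; first exact: dvdn_mulr.
have k_gt0 : 0 < k by have := posnat_gt0 x; rewrite xkd muln_gt0 => /andP[].
by exists (to_posnat k_gt0); apply: posnat_val_inj; rewrite /= xkd mulnC.
Qed.

(** A prime divisor other than [p] would be a divisor not divisible by [p]. Conversely, the least
    prime factor of a divisor greater than 1 of a [p]-number is [p]. *)
Lemma posnat_primary (p x : PN) : prime (sval p) ->
  primary p x <-> (sval p).-nat (sval x).
Proof.
move=> pp; split=> [px|px [d [e [xde [d1 pd]]]]].
  apply/pnatP; first exact: posnat_gt0.
  move=> q pq qx; rewrite inE /=; apply: contrapT => qp; apply: px.
  have /posnat_divides[c xqc] : sval (to_posnat (prime_gt0 pq)) %| sval x by [].
  exists (to_posnat (prime_gt0 pq)), c; split=> //; split.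
    by move=> /(congr1 sval) /= q1; move: (pq); rewrite q1.
  by move=> /posnat_divides /=; rewrite dvdn_prime2// eq_sym => /qp.
apply: pd; apply/posnat_divides.
have dp : (sval p).-nat (sval d) by apply: pnat_dvd px; rewrite xde dvdn_mulr.
have d_gt1 : 1 < sval d.
  rewrite ltn_neqAle posnat_gt0 andbT; apply/eqP => d1'; apply: d1.
  exact: posnat_val_inj.
have := pnatPpi dp; move/(_ (pdiv (sval d))).
rewrite pi_pdiv d_gt1 => /(_ isT); rewrite inE /= => /eqP <-.
exact: pdiv_dvd.
Qed.

(** The [p]-free elements are the numbers prime to [p], so the factorization is that into the
    [p]-part and the [p']-part. *)
Lemma posnat_splitting (p : PN) : prime (sval p) -> splitting p.
Proof.
move=> pp; have primaryE x := posnat_primary x pp.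
have freeE x : ~ divides p x <-> (sval p)^'.-nat (sval x).
  rewrite p'natE//; split=> [h|/negP h]; last by move/posnat_divides.
  by apply/negP => /posnat_divides.
split.
- move=> x; exists (to_posnat (part_gt0 (sval p) (sval x))).
  exists (to_posnat (part_gt0 (sval p)^' (sval x))); split.
    by apply: posnat_val_inj; rewrite /= partnC// posnat_gt0.
  by split; [apply/primaryE|apply/freeE]; exact: part_pnat.
- move=> y z y' z' /(congr1 sval) /= E /primaryE py /primaryE py' /freeE fz /freeE fz'.
  have yy' : sval y = sval y'.
    have := congr1 (fun n => n`_(sval p)) E.
    rewrite /= !partnM ?posnat_gt0// (part_pnat_id py) (part_pnat_id py').
    by rewrite (part_p'nat fz) (part_p'nat fz') !muln1.
  split; apply: posnat_val_inj => //.
  by move: E => /eqP; rewrite yy' eqn_pmul2l ?posnat_gt0// => /eqP.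
- move=> y y' /primaryE py /primaryE py'; apply/primaryE => /=.
  by rewrite pnatM py.
- exact/primaryE.
- by apply/primaryE; rewrite pnat_id.
- move=> z z' /freeE fz /freeE fz'; apply/freeE => /=.
  by rewrite pnatM fz.
- exact/freeE.
Qed.

Lemma posnat_orthogonal (p q : PN) : prime (sval p) -> prime (sval q) ->
  sval p <> sval q -> orthogonal p q.
Proof.
move=> pp pq npq y /(posnat_primary _ pp) py /posnat_divides qy.
have := pnat_dvd qy py; rewrite pnatE// inE /= => /eqP qp.
by apply: npq.
Qed.

Lemma posnat_coprime_splittings (p r : PN) : prime (sval p) -> prime (sval r) ->
  sval p <> sval r -> coprime_splittings p r.
Proof.
move=> pp pr npr; split; try exact: posnat_splitting; apply: posnat_orthogonal => //.
by move=> /esym.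
Qed.

(** The maps carry exponents over, sending [x] to [r ^ v_p(x)] and to [p ^ v_r(x)]. They are
    multiplicative because valuations are additive. *)
Lemma posnat_primary_iso (p r : PN) : prime (sval p) -> prime (sval r) ->
  exists f f' : PN -> PN, primary_iso p r f f' /\ f p = r.
Proof.
have expgt0 n (b : PN) (pb : prime (sval b)) (x : PN) :
    0 < sval b ^ logn n (sval x).
  by rewrite expn_gt0 prime_gt0.
have K (a b x : PN) (pa : prime (sval a)) (pb : prime (sval b)) : primary a x ->
    sval a ^ logn (sval b) (sval b ^ logn (sval a) (sval x)) = sval x.
  move=> /(posnat_primary _ pa) px.
  by rewrite pfactorK// -p_part part_pnat_id.
move=> pp pr; exists (fun x => to_posnat (expgt0 (sval p) r pr x)).
exists (fun x => to_posnat (expgt0 (sval r) p pp x)).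
have morph (a b : PN) (pb : prime (sval b)) :
    monoid_morphism (fun x => to_posnat (expgt0 (sval a) b pb x)).
  split; first by apply: posnat_val_inj; rewrite /= logn1.
  by move=> x y; apply: posnat_val_inj; rewrite /= lognM ?posnat_gt0// expnD.
have prim (a b : PN) (pb : prime (sval b)) x :
    primary b (to_posnat (expgt0 (sval a) b pb x)).
  by apply/posnat_primary => //=; rewrite pnatX pnat_id.
split; last by apply: posnat_val_inj; rewrite /= (pfactorK 1)// logn_prime// eqxx.
split=> //.
- by move=> x px; apply: posnat_val_inj; exact: K.
- by move=> x px; apply: posnat_val_inj; exact: K.
Qed.

(** In the standard model the swap at [p] and [r] is an automorphism sending [p] to [r], so both
    have the same type there; [i] preserves types. *)
Lemma prime_partial_elementary (M : structure) (i : PN -> M) (p r : PN) :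
  elementary i -> prime (sval p) -> prime (sval r) -> sval p <> sval r ->
  partial_elementary [set (i p, i r)].
Proof.
move=> eli pp pr npr V phi e He.
have cpr := posnat_coprime_splittings pp pr npr.
have [f [f' [ff' fp]]] := posnat_primary_iso pp pr.
have auth := swap_automorphism posnat_comm_monoid cpr ff'.
have hp : swap p r f f' p = r.
  rewrite (swap_primary posnat_comm_monoid cpr ff')//.
  exact: sp_primary (posnat_splitting pp).
have -> : fst \o e = i \o (fun=> p) by apply/funext => v /=; rewrite He.
have -> : snd \o e = i \o (fun=> r) by apply/funext => v /=; rewrite He.
rewrite -!(sat_elementary _ _ eli) (automorphism_elementary _ _ auth).
suff -> : swap p r f f' \o (fun=> p) = (fun=> r) :> (V -> PN) by [].
by apply/funext => v /=.
Qed.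

(** * An infinite set smaller than the monster model *)

Lemma card_beth_succ_uncountable (mu X : Type) : infinite_set [set: mu] ->
  card_beth_succ mu X -> ~ ([set: X] #<= [set: nat]).
Proof.
move=> inf_mu [W [R [beth [[woR _ nWmu] [beth0 bethS _] [bethX _]]]]] Xnat.
have wo := well_order_strict woR.
have [m0 _] := infinite_setN0 inf_mu.
(* [W] has a least element [w0] and a next one [w1], for otherwise it would embed in [mu]. Hence the
   model is at least as large as the power set of [mu]. *)
have [w0 _ w0min] : exists2 w, True & forall v, R v w /\ v <> w -> ~ True.
  apply: wf_min (swo_wf wo) _; apply: contrapT => nW; apply: nWmu.
  apply/card_le_relP; exists (fun _ _ => True).
  by split=> w; case: nW; exists w.
have [w1 w10 w1min] : exists2 w, w <> w0 & forall v, R v w /\ v <> w -> ~ v <> w0.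
  apply: wf_min (swo_wf wo) _; apply: contrapT => nW; apply: nWmu.
  have E w : w = w0 by apply: contrapT => ?; apply: nW; exists w.
  apply/card_le_relP; exists (fun _ _ => True); split=> [w _|w w' _ _ _ _ _].
    by exists m0.
  by rewrite (E w) (E w').
have seg0 : initial_segment R w0 = set0.
  by rewrite -subset0 => v /w0min; apply.
have seg1 : is_succ R w0 w1.
  rewrite /is_succ seg0 set0U; apply/seteqP; split=> v.
    by move=> /w1min /contrapT.
  move=> ->; have [|/esym//|/w0min] := swo_total wo w0 w1; first by [].
  by case.
have nat_beth0 : [set: nat] #<= [set: beth w0].
  apply: card_le_trans (iffLR (infiniteP _) inf_mu) _.
  by move: (beth0 _ seg0); rewrite card_eq_le => /andP[].
have set_nat : [set: set (beth w0)] #<= [set: nat].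
  apply: card_le_trans Xnat; apply: card_le_trans (bethX w1 I).
  by move: (bethS _ _ seg1); rewrite card_eq_le => /andP[].
move: nat_beth0 set_nat => /card_le_relP[r [rtot rinj]] /card_le_relP[s [stot sinj]].
have /choice[g gP] (n : nat) : exists t, r n t by have [//|t _] := rtot n; exists t.
have ginj m n : g m = g n -> m = n.
  by move=> gmn; apply: (rinj _ _ (g m)) => //; rewrite gmn.
have /choice[c cP] (S : set (beth w0)) : exists n, s S n.
  by have [//|n _] := stot S; exists n.
have cinj S S' : c S = c S' -> S = S'.
  by move=> cSS; apply: (sinj _ _ (c S)) => //; rewrite cSS.
(* Cantor's diagonal set for the injection taking [S] to [g (c S)]. *)
pose D := [set t | exists S, t = g (c S) /\ ~ S t].
have [DD|nDD] := pselect (D (g (c D))); last first.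
  by apply: (nDD); exists D.
by have [S [/ginj/cinj <-]] := DD.
Qed.

(** The standard elements form a countably infinite set, and the model is uncountable. *)
Lemma ex_infinite_smaller (mu : Type) (M : structure) (i : PN -> M) :
  infinite_set [set: mu] -> card_beth_succ mu M -> elementary i ->
  exists2 S : set M, infinite_set S & smaller S.
Proof.
move=> inf_mu bethM eli; exists (range i).
  (* The number [n] goes to [n + 1], as 0 is excluded from the standard model. *)
  apply/infiniteP/card_le_relP; exists (fun n x => x = i (to_posnat (ltn0Sn n))); split.
    by move=> n _; exists (i (to_posnat (ltn0Sn n))) => //; exists (to_posnat (ltn0Sn n)).
  move=> m n x _ _ -> E; suff : to_posnat (ltn0Sn m) = to_posnat (ltn0Sn n).
    by move=> /(congr1 sval) [].
  have := sat_elementary (FEq (TVar true) (TVar false)) (fun b =>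
    if b then to_posnat (ltn0Sn m) else to_posnat (ltn0Sn n)) eli.
  by move=> [_]; apply.
move=> Mi; apply: card_beth_succ_uncountable inf_mu bethM _.
apply: card_le_trans Mi _; apply: card_le_trans (card_image_le _ _) _.
exact: (@countableP {n : nat | 0 < n}).
Qed.

(** * The two swaps, at 2 and 5 and at 3 and 7, and the contradiction *)

Theorem theorem4p2 (mu : Type) (M : structure)
  (mu_infinite : infinite_set [set: mu]%classic)
  (M_monster : monster_model mu M) :
  ~ eliminates_finite_imaginaries M.
Proof.
case: M_monster => _ [i eli] spM bethM elim.
have [S0 infS0 sS0] := ex_infinite_smaller mu_infinite bethM eli.
have cM := elementary_comm_monoid eli posnat_comm_monoid.
pose nat_prime n (pn : prime n) : PN := to_posnat (prime_gt0 pn).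
pose p := i (nat_prime 2 isT); pose q := i (nat_prime 3 isT).
pose r := i (nat_prime 5 isT); pose s := i (nat_prime 7 isT).
have split_ n (pn : prime n) : splitting (i (nat_prime n pn)).
  by apply: elementary_splitting eli _; exact: posnat_splitting.
have orth m n (pm : prime m) (pn : prime n) : m <> n ->
    orthogonal (i (nat_prime m pm)) (i (nat_prime n pn)).
  by move=> mn; apply: elementary_orthogonal eli _; exact: posnat_orthogonal.
have coprime_ m n (pm : prime m) (pn : prime n) : m <> n ->
    coprime_splittings (i (nat_prime m pm)) (i (nat_prime n pn)).
  by move=> mn; split; [exact: split_|exact: split_|exact: orth|
    apply: orth => /esym].
have iso m n (pm : prime m) (pn : prime n) : m <> n -> exists f f' : M -> M,
    primary_iso (i (nat_prime m pm)) (i (nat_prime n pn)) f f' /\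
    f (i (nat_prime m pm)) = i (nat_prime n pn).
  move=> mn; have [f autf fE] := special_homogeneous spM infS0 sS0
    (@prime_partial_elementary _ i (nat_prime m pm) (nat_prime n pn) eli pm pn mn).
  by have [f' ff'] := automorphism_primary_iso autf fE; exists f, f'.
have [f [f' [ff' fp]]] := iso 2 5 isT isT ltac:(by []).
have [g [g' [gg' gq]]] := iso 3 7 isT isT ltac:(by []).
have pr : coprime_splittings p r by exact: coprime_.
have qs : coprime_splittings q s by exact: coprime_.
pose tau := swap p r f f'; pose tau' := swap q s g g'.
have prim n (pn : prime n) := sp_primary (split_ n pn).
have taup : tau p = r by rewrite /tau (swap_primary cM pr ff')//; exact: prim.
have tauq : tau q = q by apply: (swap_orthogonal cM pr ff' (prim 3 isT)); exact: orth.
have taus : tau s = s by apply: (swap_orthogonal cM pr ff' (prim 7 isT)); exact: orth.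
have taur : tau r = p by rewrite -taup /tau (swapK cM pr ff').
have tau'q : tau' q = s by rewrite /tau' (swap_primary cM qs gg')//; exact: prim.
have tau's : tau' s = q by rewrite -tau'q /tau' (swapK cM qs gg').
have tau'p : tau' p = p by apply: (swap_orthogonal cM qs gg' (prim 2 isT)); exact: orth.
have tau'r : tau' r = r by apply: (swap_orthogonal cM qs gg' (prim 5 isT)); exact: orth.
pose D : set (2.-tuple M) := [set [tuple p; q]] `|` [set [tuple r; s]].
have [|X [_ [k [b [phi [bX DE]]]] Xfix]] := elim 2 D.
  by rewrite finite_setU; split; exact: finite_set1.
have aut_tau : automorphism tau := swap_automorphism cM pr ff'.
have aut_tau' : automorphism tau' := swap_automorphism cM qs gg'.
have aut_sigma : automorphism (tau \o tau').
  case: aut_tau aut_tau' => [bt t1 tM] [bt' t1' tM']; split.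
  - exact: bij_comp.
  - by rewrite /= t1' t1.
  - by move=> x y; rewrite /= tM' tM.
have sigmapq : map_tuple (tau \o tau') [tuple p; q] = [tuple r; s].
  by apply: val_inj; rewrite /= tau'p tau'q taup taus.
have sigmars : map_tuple (tau \o tau') [tuple r; s] = [tuple p; q].
  by apply: val_inj; rewrite /= tau'r tau's taur tauq.
have sigmaD : [set map_tuple (tau \o tau') x | x in D] = D.
  apply/seteqP; split=> [_ [x [->|->] <-]|x [->|->]].
  - by rewrite sigmapq; right.
  - by rewrite sigmars; left.
  - by exists [tuple r; s] => //; right.
  - by exists [tuple p; q] => //; left.
have tauX x : X x -> tau x = x.
  move=> /(Xfix _ aut_sigma sigmaD) /= xE; apply: (swap_fix cM pr ff').
  have [_ rx _] := primary_partP x (split_ 5 isT).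
  (* Compare the [p]-parts of [x] and of its equal image under [tau \o tau']: [tau] turns the
     [r]-part of [tau' x] into a [p]-part by [f'], and [tau'] leaves [r]-parts alone. *)
  have pE : primary_part p x = f' (primary_part r x).
    rewrite -{1}xE (swap_primary_part_l cM pr ff') /tau'.
    by rewrite (swap_primary_part_other cM qs gg' _ (split_ 5 isT)) //; exact: orth.
  by rewrite pE (pi_K' ff' rx).
(* Equality would make the first prime, which is primary for itself, divisible by the second,
   against orthogonality. *)
have neq m n (pm : prime m) (pn : prime n) : m <> n ->
    i (nat_prime m pm) <> i (nat_prime n pn).
  move=> mn E; apply: (orth m n pm pn mn _ (prim m pm)).
  by rewrite -E; exact: divides_refl.
have Dpq : D [tuple p; q] by left.
(* [tau] fixes the parameters of [phi] and takes [(p, q)] to [(r, q)], so it transports membership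
   in [D]. *)
have : D [tuple r; q].
  move: Dpq; rewrite DE /= (automorphism_elementary _ _ aut_tau).
  set e1 := _ \o _; set e2 := (X in _ -> sat phi X); suff -> : e1 = e2 by [].
  apply/funext => -[j|j]; rewrite /e1 /e2 /=; last exact: tauX.
  by case: j => -[|[|//]] lt_j.
case=> /(congr1 val) [].
  by move=> /esym; exact: neq.
by move=> /(neq 3 7 isT isT ltac:(by [])).
Qed.
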